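(* Let $(M,g,S(TM),S(TM^\perp))$ be an irrotational ascreen (proper) QGCR-lightlike submanifold of an indefinite nearly $\mu$-Sasakian manifold $(\overline{M},\overline{\phi},\xi,\eta,\overline{g})$, and suppose that the induced connection $\nabla$ on $TM$ is a metric connection, i.e. $(\nabla_X g)(Y,Z)=0$ for all $X,Y,Z\in\Gamma(TM)$. If $\mathrm{trace}(A_{W_\alpha})|_{S(TM)}=0$ for every $\alpha$, where $\{W_\alpha\}$ is a local orthonormal frame of $S(TM^\perp)$, then $M$ is minimal.
   Context: Ambient manifold. An indefinite almost contact metric manifold $(\overline{M},\overline{\phi},\xi,\eta,\overline{g})$ is an odd-dimensional manifold with a $(1,1)$-tensor $\overline{\phi}$, a vector field $\xi$, a 1-form $\eta$ and a semi-Riemannian metric $\overline{g}$ with $\overline{\phi}^2=-\mathbb{I}+\eta\otimes\xi$, $\eta(\xi)=1$, $\eta\circ\overline{\phi}=0$, $\overline{\phi}\xi=0$, $\overline{g}(\overline{\phi}X,\overline{\phi}Y)=\overline{g}(X,Y)-\eta(X)\eta(Y)$, $\eta(X)=\overline{g}(\xi,X)$. With $\overline{\nabla}$ the Levi-Civita connection of $\overline{g}$ and $\mu$ a real constant, it is indefinite nearly $\mu$-Sasakian if $(\overline{\nabla}_X\overline{\phi})Y+(\overline{\nabla}_Y\overline{\phi})X=\mu\{2\overline{g}(X,Y)\xi-\eta(Y)X-\eta(X)Y\}$ for all vector fields $X,Y$ on $\overline{M}$. Lightlike submanifolds. $M$ is a submanifold of $\overline{M}$ with induced (degenerate) metric $g$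 such that $\mathrm{Rad}\,TM=TM\cap TM^\perp$ is a smooth distribution of rank $r>0$. $S(TM)$ (screen distribution) is a chosen non-degenerate complement of $\mathrm{Rad}\,TM$ in $TM$, and $S(TM^\perp)$ a chosen non-degenerate complement of $\mathrm{Rad}\,TM$ in $TM^\perp$. For a local basis $\{E_i\}$ of $\mathrm{Rad}\,TM$ there are local sections $\{N_i\}$ of the orthogonal complement of $S(TM^\perp)$ in $S(TM)^\perp$ with $\overline{g}(E_i,N_j)=\delta_{ij}$, $\overline{g}(N_i,N_j)=0$; they span the lightlike transversal bundle $l\mathrm{tr}(TM)$. Put $\mathrm{tr}(TM)=l\mathrm{tr}(TM)\perp S(TM^\perp)$, so $T\overline{M}|_M=TM\oplus\mathrm{tr}(TM)$. For $X,Y\in\Gamma(TM)$ write $\overline{\nabla}_XY=\nabla_XY+h(X,Y)$ with $\nabla_XY\in\Gamma(TM)$ (induced connection) and $h(X,Y)=h^l(X,Y)+h^s(X,Y)$, $h^l(X,Y)\in\Gamma(l\mathrm{tr}(TM))$, $h^s(X,Y)\in\Gamma(S(TM^\perp))$. For $W\in\Gamma(S(TM^\perp))$, $A_WX\in\Gamma(TM)$ is minus the $TM$-component of $\overline{\nabla}_XW$ in $TM\oplus\mathrm{tr}(TM)$. Traces on $S(TM)$ are taken with respect to $g$ restricted to $S(TM)$: for a local orthonormal frame $\{e_a\}$ of $S(TM)$ with $\epsilon_a=g(e_a,e_a)=\pm1$, $\mathrm{trace}(h)|_{S(TM)}=\sum_a\epsilon_a h(e_a,e_a)$ and $\mathrm{trace}(A_W)|_{S(TM)}=\sum_a\epsilon_a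 g(A_We_a,e_a)$. QGCR-lightlike. $(M,g,S(TM),S(TM^\perp))$ is quasi generalized CR (QGCR)-lightlike if: (i) there are distributions $D_1,D_2$ of $\mathrm{Rad}\,TM$ with $\mathrm{Rad}\,TM=D_1\oplus D_2$, $\overline{\phi}D_1=D_1$, $\overline{\phi}D_2\subset S(TM)$; (ii) there are vector subbundles $D_0,\overline{D}$ of $S(TM)$ with $S(TM)=\{\overline{\phi}D_2\oplus\overline{D}\}\perp D_0$, $\overline{\phi}D_0\subseteq D_0$, $\overline{D}=\overline{\phi}\mathcal{S}\oplus\overline{\phi}\mathcal{L}$, where $D_0$ is non-degenerate and $\mathcal{L}$, $\mathcal{S}$ are vector subbundles of $l\mathrm{tr}(TM)$ and $S(TM^\perp)$ respectively. Here the sum of $\overline{\phi}D_2$ and $\overline{\phi}\mathcal{L}$ inside $S(TM)$ need not be direct. It is proper if $D_1,D_0,D_2,\mathcal{S}$ are all nonzero; QGCR-lightlike submanifolds are assumed proper. Ascreen: $\xi$ restricted to $M$ is a section of $\mathrm{Rad}\,TM\oplus l\mathrm{tr}(TM)$. Irrotational: $\overline{\nabla}_XE\in\Gamma(TM)$ for all $X\in\Gamma(TM)$, $E\in\Gamma(\mathrm{Rad}\,TM)$; equivalently $h^l(X,E)=h^s(X,E)=0$ for all such $X,E$. Minimal: $h^s=0$ on $\mathrm{Rad}\,TM$ (i.e. $h^s(E,E')=0$ for $E,E'\in\Gamma(\mathrm{Rad}\,TM)$) and $\mathrm{trace}(h)|_{S(TM)}=0$. *)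

(* Defs.v *)
From HB Require Import structures.
From mathcomp Require Import all_boot all_order all_algebra.
From mathcomp Require Import all_classical all_reals all_analysis.
Import Order.TTheory GRing.Theory Num.Theory.
Import numFieldNormedType.Exports.

Set Implicit Arguments.
Unset Strict Implicit.
Unset Printing Implicit Defensive.

Local Open Scope classical_set_scope.
Local Open Scope ring_scope.

(* Conventions.  Functions and fields are total, and every regularity or
   membership condition is imposed near a point only, so that a total function
   stands for its germs.  Hence all sections below are local sections; the
   values of a function or field away from the region where it is required to
   be smooth play no role. *)

Section smooth_functions.
Context {R : realType} {n : nat}.
Implicit Types (A : set 'rV[R]_n) (f : 'rV[R]_n -> R^o).

Fixpoint Ck_on (k : nat) A f : Prop :=
  match k with
  | 0 => forall x, A x -> {for x, continuous f}
  | k'.+1 => (forall x, A x -> differentiable f x) /\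
             forall j : 'I_n, Ck_on k' A (fun x => 'D_(delta_mx 0 j) f x)
  end.

Definition smooth_near f (a : 'rV[R]_n) : Prop :=
  exists A, [/\ open A, A a & forall k, Ck_on k A f].

End smooth_functions.

Record manifold (R : realType) (n : nat) := Manifold {
  mcarrier :> topologicalType ;
  chart : Type ;
  chart_dom : chart -> set mcarrier ;
  chart_map : chart -> mcarrier -> 'rV[R]_n ;
  chart_inv : chart -> 'rV[R]_n -> mcarrier ;
  hausdorff_mcarrier : hausdorff_space mcarrier ;
  second_countable_mcarrier : @second_countable mcarrier ;
  chart_cover : forall p, exists c, chart_dom c p ;
  open_chart_dom : forall c, open (chart_dom c) ;
  open_chart_image : forall c, open (chart_map c @` chart_dom c) ;
  chart_mapK : forall c p, chart_dom c p -> chart_inv c (chart_map c p) = p ;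
  chart_map_continuous : forall c p, chart_dom c p -> {for p, continuous (chart_map c)} ;
  chart_inv_continuous : forall c p, chart_dom c p ->
        {for chart_map c p, continuous (chart_inv c)} ;
  chart_transition_smooth : forall c c' p, chart_dom c p -> chart_dom c' p -> forall j : 'I_n,
        smooth_near (fun x => chart_map c' (chart_inv c x) 0 j) (chart_map c p)
}.

(* Tangent vectors are directional derivative operators on functions; this is
   the ambient vector space of operators in which they live. *)
Notation operator R M := ((M -> R) -> R^o).

Section tangent_vectors.
Context {R : realType} {n : nat} {M : manifold R n}.

Definition smooth_at (p : M) (f : M -> R) : Prop :=
  forall c, chart_dom c p -> smooth_near (f \o chart_inv c) (chart_map c p).

(* The vector \sum_j w_j d/dx_j at p in the chart c.  Operators are normalized
   to vanish on functions that are not smooth near p, so that equality of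
   tangent vectors is equality of operators. *)
Definition coord_vec (c : chart M) (w : 'rV[R]_n) (p : M) : operator R M :=
  fun f => if `[< smooth_at p f >]
           then 'D_w (f \o chart_inv c : 'rV[R]_n -> R^o) (chart_map c p)
           else 0.

Definition tangent (p : M) : set (operator R M) :=
  [set v | exists c w, chart_dom c p /\ v = coord_vec c w p].

End tangent_vectors.

Section vector_spaces.
Context {R : realType} {V : lmodType R}.
Implicit Types A B C : set V.

Definition vsum A B : set V := [set u | exists a b, [/\ A a, B b & u = a + b]].

Definition direct_sum C A B : Prop :=
  C = vsum A B /\ forall v, A v -> B v -> v = 0.

Definition is_basis (k : nat) A (e : 'I_k -> V) : Prop :=
  (forall v, A v <-> exists c : 'I_k -> R, v = \sum_a c a *: e a) /\
  (forall c : 'I_k -> R, \sum_a c a *: e a = 0 -> forall a, c a = 0).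

End vector_spaces.

(* The component of v in A along the direct sum of A and B. *)
Definition component {R : realType} {T : Type} (A B : set (T -> R^o))
    (v : T -> R^o) : T -> R^o :=
  xget 0 [set a | A a /\ exists b, B b /\ v = a + b].

Section maps.
Context {R : realType} {m n : nat} {M : manifold R m} {N : manifold R n}.
Variable i : M -> N.

Definition smooth_map : Prop :=
  continuous i /\
  forall p c c', chart_dom c p -> chart_dom c' (i p) -> forall j : 'I_n,
    smooth_near (fun x => chart_map c' (i (chart_inv c x)) 0 j) (chart_map c p).

Definition differential (p : M) (x : operator R M) : operator R N :=
  fun f => if `[< smooth_at (i p) f >] then x (f \o i) else 0.

Definition immersed_submanifold : Prop :=
  [/\ injective i, smooth_map &
      forall p x, tangent p x -> differential p x = 0 -> x = 0].

(* V is near p a smooth section of the pullback of TN by i. *)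
Definition smooth_along (V : M -> operator R N) (p : M) : Prop :=
  (\forall q \near p, tangent (i q) (V q)) /\
  forall f, smooth_at (i p) f -> smooth_at p (fun q => V q f).

End maps.

Notation smooth_field := (smooth_along id).

Section connections.
Context {R : realType} {m n : nat} {M : manifold R m} {N : manifold R n}.

(* D p x V is the covariant derivative at p of the field V along i in the
   direction of the tangent vector x of M at p. *)
Definition connection_along (i : M -> N)
    (D : M -> operator R M -> (M -> operator R N) -> operator R N) : Prop :=
  [/\ forall p x V, tangent p x -> smooth_along i V p ->
        tangent (i p) (D p x V),
      forall p (a : R) x y V, tangent p x -> tangent p y ->
        smooth_along i V p -> D p (a *: x + y) V = a *: D p x V + D p y V,
      forall p x V W, tangent p x -> smooth_along i V p ->
        smooth_along i W p -> D p x (fun q => V q + W q) = D p x V + D p x W,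
      forall p x f V, tangent p x -> smooth_at p f -> smooth_along i V p ->
        D p x (fun q => f q *: V q) = x f *: V p + f p *: D p x V &
      forall p X V, smooth_field X p -> smooth_along i V p ->
        smooth_along i (fun q => D q (X q) V) p].

End connections.

Section metric.
Context {R : realType} {n : nat} {N : manifold R n}.
Implicit Types (nb : N -> operator R N -> (N -> operator R N) -> operator R N)
  (X Y Z : N -> operator R N).
Variable g : N -> operator R N -> operator R N -> R.

Definition nondegenerate_on (p : N) (F : set (operator R N)) : Prop :=
  forall v, F v -> (forall w, F w -> g p v w = 0) -> v = 0.

(* The last clause says that the index is constant, equal to q. *)
Definition semi_riemannian : Prop :=
  [/\ forall p v w, tangent p v -> tangent p w -> g p v w = g p w v,
      forall p (a : R) u v w, tangent p u -> tangent p v -> tangent p w ->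
        g p (a *: u + v) w = a * g p u w + g p v w,
      forall p, nondegenerate_on p (tangent p),
      forall p X Y, smooth_field X p -> smooth_field Y p ->
        smooth_at p (fun r => g r (X r) (Y r)) &
      exists q : nat, (q <= n)%N /\ forall p, exists e : 'I_n -> operator R N,
        is_basis (tangent p) e /\
        forall a b, g p (e a) (e b) =
          if a == b then (if (a < q)%N then -1 else 1) else 0].

Definition lie_bracket X Y (p : N) : operator R N :=
  fun f => if `[< smooth_at p f >]
           then X p (fun q => Y q f) - Y p (fun q => X q f) else 0.

Definition levi_civita nb : Prop :=
  [/\ connection_along id nb,
      forall p X Y, smooth_field X p -> smooth_field Y p ->
        nb p (X p) Y - nb p (Y p) X = lie_bracket X Y p &
      forall p x Y Z, tangent p x -> smooth_field Y p -> smooth_field Z p ->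
        x (fun q => g q (Y q) (Z q)) =
        g p (nb p x Y) (Z p) + g p (Y p) (nb p x Z)].

Definition almost_contact_metric (phi : N -> operator R N -> operator R N)
    (xi : N -> operator R N) (eta : N -> operator R N -> R) : Prop :=
  [/\ semi_riemannian,
      [/\ forall p v, tangent p v -> tangent p (phi p v),
          forall p (a : R) v w, tangent p v -> tangent p w ->
            phi p (a *: v + w) = a *: phi p v + phi p w &
          forall p X, smooth_field X p ->
            smooth_field (fun q => phi q (X q)) p],
      forall p, smooth_field xi p,
      (forall p (a : R) v w, tangent p v -> tangent p w ->
        eta p (a *: v + w) = a * eta p v + eta p w) /\
      (forall p X, smooth_field X p -> smooth_at p (fun q => eta q (X q))) &
      [/\ forall p v, tangent p v -> phi p (phi p v) = - v + eta p v *: xi p,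
          forall p, eta p (xi p) = 1,
          forall p v, tangent p v -> eta p (phi p v) = 0,
          forall p, phi p (xi p) = 0 &
          (forall p v w, tangent p v -> tangent p w ->
            g p (phi p v) (phi p w) = g p v w - eta p v * eta p w) /\
          (forall p v, tangent p v -> eta p v = g p (xi p) v)]].

(* (nb_x phi) Y *)
Definition cov_tensor nb (phi : N -> operator R N -> operator R N)
    (p : N) (x : operator R N) Y : operator R N :=
  nb p x (fun q => phi q (Y q)) - phi p (nb p x Y).

Definition nearly_sasakian nb (mu : R)
    (phi : N -> operator R N -> operator R N)
    (xi : N -> operator R N) (eta : N -> operator R N -> R) : Prop :=
  forall p X Y, smooth_field X p -> smooth_field Y p ->
    cov_tensor nb phi p (X p) Y + cov_tensor nb phi p (Y p) X =
    mu *: ((2 * g p (X p) (Y p)) *: xi p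
           - eta p (Y p) *: X p - eta p (X p) *: Y p).

End metric.

Section submanifolds.
Context {R : realType} {m n : nat} {M : manifold R m} {N : manifold R n}.
Variable i : M -> N.
Variable g : N -> operator R N -> operator R N -> R.

(* Families of subspaces of the spaces T_(i p) N, p in M.  Vectors tangent to
   M are identified with their images under the differential of i. *)
Local Notation family := (M -> set (operator R N)).
Local Notation field := (M -> operator R N).
Implicit Types (F : family) (V Y Z W E : field) (v : operator R N).

Definition TM : family :=
  fun p => [set differential i p x | x in tangent p].

Definition lift (p : M) v : operator R M :=
  xget 0 [set x | tangent p x /\ differential i p x = v].

Definition local_frame F (k : nat) (e : 'I_k -> field) (p : M) : Prop :=
  (forall a, smooth_along i (e a) p) /\
  \forall q \near p, is_basis (F q) (fun a => e a q).

Definition subbundle_of_rank (k : nat) F : Prop :=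
  forall p, exists e : 'I_k -> field, local_frame F e p.

Definition subbundle F : Prop := exists k, subbundle_of_rank k F.

Definition nonzero_bundle F : Prop :=
  subbundle F /\ forall p, exists v, F p v /\ v <> 0.

Definition is_section F V (p : M) : Prop :=
  smooth_along i V p /\ \forall q \near p, F q (V q).

Definition perp F : family := fun p =>
  [set v | tangent (i p) v /\ forall w, F p w -> g (i p) v w = 0].

Definition orthogonal F F' : Prop :=
  forall p v w, F p v -> F' p w -> g (i p) v w = 0.

Definition Rad : family := fun p => TM p `&` perp TM p.

Definition orthonormal_frame F (k : nat) (e : 'I_k -> field) (p : M) : Prop :=
  local_frame F e p /\
  \forall q \near p, forall a b,
    if a == b then g (i q) (e a q) (e a q) = 1 \/ g (i q) (e a q) (e a q) = -1
    else g (i q) (e a q) (e b q) = 0.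

(* S is the screen distribution S(TM), St the screen transversal bundle
   S(TM^perp) and ltr a lightlike transversal bundle. *)
Definition lightlike_submanifold (S St ltr : family) : Prop :=
  [/\ exists r, (0 < r)%N /\ subbundle_of_rank r Rad,
      [/\ subbundle S, forall p, nondegenerate_on g (i p) (S p) &
          forall p, direct_sum (TM p) (Rad p) (S p)],
      [/\ subbundle St, forall p, nondegenerate_on g (i p) (St p) &
          forall p, direct_sum (perp TM p) (Rad p) (St p)] &
      forall p r (E : 'I_r -> field), local_frame Rad E p ->
        exists Nf : 'I_r -> field, local_frame ltr Nf p /\
          \forall q \near p, forall a b,
            [/\ perp S q (Nf a q), perp St q (Nf a q),
                g (i q) (E a q) (Nf b q) = (a == b)%:R &
                g (i q) (Nf a q) (Nf b q) = 0]].

(* In S(TM) = {phi D2 (+) Dbar} _|_ D0 the sum of phi D2 and Dbar need not be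
   direct, since phi D2 and phi Ls may intersect. *)
Definition proper_QGCR (phi : N -> operator R N -> operator R N)
    (S St ltr : family) : Prop :=
  let Phi F : family := fun p => phi (i p) @` F p in
  exists D1 D2 D0 Dbar Ss Ls : family,
  [/\ [/\ nonzero_bundle D1, nonzero_bundle D2, nonzero_bundle D0,
          nonzero_bundle Ss & subbundle Dbar /\ subbundle Ls],
      [/\ forall p, direct_sum (Rad p) (D1 p) (D2 p),
          forall p, Phi D1 p = D1 p &
          forall p, Phi D2 p `<=` S p],
      [/\ forall p, D0 p `<=` S p, forall p, Dbar p `<=` S p,
          forall p, nondegenerate_on g (i p) (D0 p) &
          forall p, Phi D0 p `<=` D0 p],
      [/\ forall p, Ls p `<=` ltr p, forall p, Ss p `<=` St p &
          forall p, direct_sum (Dbar p) (Phi Ss p) (Phi Ls p)] &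
      (forall p, direct_sum (S p) (vsum (Phi D2 p) (Dbar p)) (D0 p)) /\
      orthogonal (fun p => vsum (Phi D2 p) (Dbar p)) D0].

Definition ascreen (xi : N -> operator R N) (ltr : family) : Prop :=
  forall p, vsum (Rad p) (ltr p) (xi (i p)).

(* D is the connection induced by nb on the pullback of TN by i. *)
Definition pullback_connection
    (nb : N -> operator R N -> (N -> operator R N) -> operator R N)
    (D : M -> operator R M -> field -> operator R N) : Prop :=
  connection_along i D /\
  forall p x (Z : N -> operator R N), tangent p x -> smooth_field Z (i p) ->
    D p x (fun q => Z (i q)) = nb (i p) (differential i p x) Z.

Section gauss_weingarten.
Variables (D : M -> operator R M -> field -> operator R N)
  (S St ltr : family).

Definition cov (p : M) v V : operator R N := D p (lift p v) V.

Definition tr : family := fun p => vsum (ltr p) (St p).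

Definition induced_connection (p : M) v Y : operator R N :=
  component (TM p) (tr p) (cov p v Y).

Definition sff (p : M) v Y : operator R N :=
  component (tr p) (TM p) (cov p v Y).

Definition sff_s (p : M) v Y : operator R N :=
  component (St p) (ltr p) (sff p v Y).

Definition shape W (p : M) v : operator R N :=
  - component (TM p) (tr p) (cov p v W).

Definition irrotational : Prop :=
  forall p v E, TM p v -> is_section Rad E p -> TM p (cov p v E).

Definition metric_induced_connection : Prop :=
  forall p v Y Z, TM p v -> is_section TM Y p -> is_section TM Z p ->
    lift p v (fun q => g (i q) (Y q) (Z q))
    - g (i p) (induced_connection p v Y) (Z p)
    - g (i p) (Y p) (induced_connection p v Z) = 0.

Definition trace_sff (k : nat) (e : 'I_k -> field) (p : M) : operator R N :=
  \sum_a g (i p) (e a p) (e a p) *: sff p (e a p) (e a).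

Definition trace_shape (k : nat) (e : 'I_k -> field) W (p : M) : R :=
  \sum_a g (i p) (e a p) (e a p) * g (i p) (shape W p (e a p)) (e a p).

Definition minimal : Prop :=
  (forall p E E', is_section Rad E p -> is_section Rad E' p ->
    sff_s p (E p) E' = 0) /\
  (forall p k (e : 'I_k -> field), orthonormal_frame S e p ->
    trace_sff e p = 0).

(* Around every point some orthonormal frame of S(TM^perp) has trace-free
   shape operators on S(TM). *)
Definition trace_free_shape : Prop :=
  forall p, exists l, exists W : 'I_l -> field,
    orthonormal_frame St W p /\
    \forall q \near p, forall a k (e : 'I_k -> field),
      orthonormal_frame S e q -> trace_shape e (W a) q = 0.

End gauss_weingarten.

End submanifolds.

(* Main.v *)
(* Let E be a section of Rad TM.  Since the ambient connection and the induced
   connection are both compatible with g, and the ambient derivative of E is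
   tangent to M by irrotationality, the two product rules for g(Y, E) differ
   by g(h(X, Y), E), which therefore vanishes; the pairing of Rad TM with
   ltr(TM) is perfect, so h takes values in S(TM^perp).  Differentiating
   g(Y, W) = 0 for Y in S(TM) and W in S(TM^perp) gives
   g(h(X, Y), W) = g(A_W X, Y), so trace(h) on S(TM) is orthogonal to every
   W_alpha.  Compatibility of the pullback connection with g is reduced to that
   of the Levi-Civita connection by expanding fields along the immersion in the
   coordinate fields of a chart. *)
Require Import Defs.
From HB Require Import structures.
From mathcomp Require Import all_boot all_order all_algebra.
From mathcomp Require Import all_classical all_reals all_analysis.
Import Order.TTheory GRing.Theory Num.Theory.
Import numFieldNormedType.Exports.

Set Implicit Arguments.
Unset Strict Implicit.
Unset Printing Implicit Defensive.

Local Open Scope classical_set_scope.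
Local Open Scope ring_scope.

(** * Differentiability and the chain rule for maps into row vectors *)

Section differentiation.
Context {R : realType}.

(** The difference [h - f] vanishes near [x], so it is negligible to every order there and has zero
    differential; [h] is then [f] plus a differentiable function. *)
Lemma near_eq_differentiable {V W : normedModType R} (f h : V -> W) (x : V) :
  (\near x, f x = h x) -> differentiable f x -> differentiable h x.
Proof.
move=> fh df; have -> : h = f + (h - f) by rewrite addrC subrK.
apply: differentiableD => //; apply/diff_locallyP.
have e0 : (h - f) \o shift x = cst ((h - f) x) + (\0 : V -> W) +o_ 0 id.
  apply/eqaddoP => _/posnumP[e].
  have : \forall y \near 0, f (y + x) = h (y + x).
    by move: fh; rewrite (near_shift 0) subr0.
  apply: filterS => y /= fy.
  rewrite !fctE /= fy subrr (nbhs_singleton fh) subrr addr0 subrr normr0.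
  by rewrite mulr_ge0.
have -> : 'd (h - f) x = \0 :> (V -> W).
  by apply: (@diff_unique _ _ _ _ \0) => //; exact: cst_continuous.
by split => //; exact: cst_continuous.
Qed.

Lemma differentiable_row {V : normedModType R} {n : nat} (G : V -> 'rV[R]_n) x :
  (forall j, differentiable (fun y => G y 0 j : R^o) x) -> differentiable G x.
Proof.
move=> dG; have -> : G = \sum_j (fun y => G y 0 j *: delta_mx 0 j).
  by apply/funext => y; rewrite fct_sumE [LHS]row_sum_delta.
by apply: differentiable_sum => j; exact: differentiableZl.
Qed.

Lemma derive_comp_row {V : normedModType R} {n : nat} (G : V -> 'rV[R]_n)
    (f : 'rV[R]_n -> R^o) x v :
  differentiable G x -> differentiable f (G x) ->
  'D_v (f \o G) x = 'D_('D_v G x) f (G x).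
Proof.
move=> dG df; rewrite !deriveE//; last exact: differentiable_comp.
by rewrite diff_comp.
Qed.

Lemma derive_row {n : nat} (f : 'rV[R]_n -> R^o) x w :
  differentiable f x -> 'D_w f x = \sum_j w 0 j * 'D_(delta_mx 0 j) f x.
Proof.
move=> df; rewrite deriveE// [in LHS](row_sum_delta w) linear_sum.
by apply: eq_bigr => j _; rewrite linearZ deriveE.
Qed.

Lemma derive_rowE {V : normedModType R} {n : nat} (G : V -> 'rV[R]_n) x v j :
  differentiable G x -> ('D_v G x) 0 j = 'D_v (fun y => G y 0 j : R^o) x.
Proof.
by move=> dG; rewrite derive_mx ?mxE//; exact: diff_derivable.
Qed.

End differentiation.

(** * Stability of the classes C^k on open sets *)

Section Ck.
Context {R : realType}.

(** Since [A] is open, agreement on [A] is agreement near each of its points, and so it passes to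
    all partial derivatives. *)
Lemma Ck_on_eq {n} k (A : set 'rV[R]_n) (f h : 'rV[R]_n -> R^o) : open A ->
  (forall x, A x -> f x = h x) -> Ck_on k A f -> Ck_on k A h.
Proof.
move=> oA; have nfh (u v : 'rV[R]_n -> R^o) (x : 'rV[R]_n) :
    (forall y, A y -> u y = v y) -> A x -> \forall y \near x, u y = v y.
  move=> uv Ax; have : nbhs x A by exact: open_nbhs_nbhs.
  exact: filterS.
elim: k f h => [|k IH] f h fh.
  move=> cf x Ax; rewrite /prop_for /continuous_at -fh //.
  apply: cvg_trans (cf x Ax). exact: (@near_eq_cvg _ _ (nbhs x) _ f h (nfh f h x fh Ax)).
move=> [df Df]; split=> [x Ax|j].
  by apply: near_eq_differentiable (df x Ax); exact: nfh.
apply: IH (Df j) => x Ax; apply: near_eq_derive; exact: nfh.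
Qed.

Lemma Ck_on_subset {n} k (A B : set 'rV[R]_n) (f : 'rV[R]_n -> R^o) :
  B `<=` A -> Ck_on k A f -> Ck_on k B f.
Proof.
move=> BA; elim: k f => [|k IH] f /=; first by move=> cf x /BA; exact: cf.
by move=> [df Df]; split=> [x /BA|j]; [exact: df|exact: IH].
Qed.

(** Serves the inductions for products and composites, where the formula for the first derivative
    still contains the original functions. *)
Lemma Ck_onW {n} k (A : set 'rV[R]_n) (f : 'rV[R]_n -> R^o) :
  Ck_on k.+1 A f -> Ck_on k A f.
Proof.
elim: k f => [|k IH] f [df Df]; first by move=> x /df/differentiable_continuous.
by split=> // j; exact: IH.
Qed.

Lemma Ck_on_cst {n} k (A : set 'rV[R]_n) (a : R) : Ck_on k A (cst a : _ -> R^o).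
Proof.
elim: k a => [|k IH] a /=; first by move=> x _; exact: cst_continuous.
split=> // j; rewrite (_ : (fun _ => _) = cst 0) //.
by apply/funext => x; rewrite derive_cst.
Qed.

Lemma Ck_onD {n} k (A : set 'rV[R]_n) (f h : 'rV[R]_n -> R^o) : open A ->
  Ck_on k A f -> Ck_on k A h -> Ck_on k A (f + h).
Proof.
move=> oA; elim: k f h => [|k IH] f h /=.
  by move=> cf ch x Ax; apply: continuousD; [exact: cf|exact: ch].
move=> [df Df] [dh Dh]; split=> [x Ax|j].
  by apply: differentiableD; [exact: df|exact: dh].
apply: Ck_on_eq (IH _ _ (Df j) (Dh j)) => // x Ax.
by rewrite deriveD //; apply: diff_derivable; [exact: df|exact: dh].
Qed.

Lemma Ck_onM {n} k (A : set 'rV[R]_n) (f h : 'rV[R]_n -> R^o) : open A ->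
  Ck_on k A f -> Ck_on k A h -> Ck_on k A (f * h).
Proof.
move=> oA; elim: k f h => [|k IH] f h.
  by move=> cf ch x Ax; apply: continuousM; [exact: cf|exact: ch].
move=> Cf Ch; have [df Df] := Cf; have [dh Dh] := Ch; split=> [x Ax|j].
  by apply: differentiableM; [exact: df|exact: dh].
apply: (@Ck_on_eq _ _ _ (f * 'D_(delta_mx 0 j) h + h * 'D_(delta_mx 0 j) f)) => //.
  by move=> x Ax; rewrite deriveM //; apply: diff_derivable; [exact: df|exact: dh].
apply: Ck_onD => //; apply: IH => //; [exact: Ck_onW|exact: Dh|exact: Ck_onW|exact: Df].
Qed.

Lemma Ck_on_sum {n} k (A : set 'rV[R]_n) p (f : 'I_p -> 'rV[R]_n -> R^o) : open A ->
  (forall l, Ck_on k A (f l)) -> Ck_on k A (\sum_l f l).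
Proof.
move=> oA Cf; apply: (big_ind (Ck_on k A)) => //; first exact: Ck_on_cst.
by move=> ? ?; exact: Ck_onD.
Qed.

(** Induction on [k]: by the chain rule each partial derivative of the composite is a sum of
    products of a partial derivative of [f] composed with [G], of class C^k by induction, and a
    partial derivative of a component of [G]. *)
Lemma Ck_on_comp {m n} k (A : set 'rV[R]_n) (B : set 'rV[R]_m)
    (G : 'rV[R]_m -> 'rV[R]_n) (f : 'rV[R]_n -> R^o) : open A -> open B ->
  (forall x, B x -> A (G x)) -> (forall x, B x -> differentiable G x) ->
  (forall l, Ck_on k B (fun x => G x 0 l)) -> Ck_on k A f -> Ck_on k B (f \o G).
Proof.
move=> oA oB BA dG; elim: k f => [|k IH] f CG.
  move=> cf x Bx; apply: continuous_comp; last exact/cf/BA.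
  exact/differentiable_continuous/dG.
move=> [df Df]; split=> [x Bx|j].
  by apply: differentiable_comp; [exact: dG|exact/df/BA].
pose D l := ('D_(delta_mx 0 l) f \o G) * 'D_(delta_mx 0 j) (fun x => G x 0 l : R^o).
apply: (@Ck_on_eq _ _ _ (\sum_l D l)) => //.
  move=> x Bx; rewrite derive_comp_row; [|exact: dG|exact/df/BA].
  rewrite derive_row; last exact/df/BA.
  rewrite fct_sumE; apply: eq_bigr => l _; rewrite derive_rowE; last exact: dG.
  by rewrite mulrC.
apply: Ck_on_sum => // l; apply: Ck_onM => //; last by have [_] := CG l; apply.
by apply: IH (Df l) => l'; exact: Ck_onW.
Qed.

End Ck.

(** * Germs of smooth functions on coordinate space *)

Section smooth_near.
Context {R : realType}.

Lemma smooth_near_eq {n} (f h : 'rV[R]_n -> R^o) a :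
  (\near a, f a = h a) -> smooth_near f a -> smooth_near h a.
Proof.
move=> fh [A [oA Aa Cf]].
(* The two functions agree near [a] only; the interior gives an open set on which they agree
   throughout. *)
exists (A `&` [set x | f x = h x]°); split=> [||k].
- exact: openI (open_interior _).
- by split.
- apply: (@Ck_on_eq _ _ _ _ f); first exact: openI (open_interior _).
    by move=> x [_ /interior_subset].
  by apply: Ck_on_subset (Cf k) => x [].
Qed.

Lemma smooth_near_near {n} (f : 'rV[R]_n -> R^o) a :
  smooth_near f a -> \forall x \near a, smooth_near f x.
Proof.
move=> [A [oA Aa Cf]]; have : nbhs a A by exact: open_nbhs_nbhs.
by apply: filterS => x Ax; exists A.
Qed.

Lemma smooth_near_differentiable {n} (f : 'rV[R]_n -> R^o) a :
  smooth_near f a -> differentiable f a.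
Proof. by move=> [A [oA Aa /(_ 1%N)[df _]]]; exact: df. Qed.

Lemma smooth_near_partial {n} (f : 'rV[R]_n -> R^o) a j :
  smooth_near f a -> smooth_near ('D_(delta_mx 0 j) f) a.
Proof.
by move=> [A [oA Aa Cf]]; exists A; split=> // k; have [_] := Cf k.+1; apply.
Qed.

Lemma smooth_near_cst {n} (c : R) a : smooth_near (cst c : 'rV[R]_n -> R^o) a.
Proof. by exists setT; split=> //; [exact: openT|move=> k; exact: Ck_on_cst]. Qed.

Lemma smooth_nearD {n} (f h : 'rV[R]_n -> R^o) a :
  smooth_near f a -> smooth_near h a -> smooth_near (f + h) a.
Proof.
move=> [A [oA Aa Cf]] [B [oB Ba Ch]]; have oAB := openI oA oB.
exists (A `&` B); split=> // k; apply: Ck_onD => //.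
  by apply: Ck_on_subset (Cf k) => x [].
by apply: Ck_on_subset (Ch k) => x [].
Qed.

Lemma smooth_nearM {n} (f h : 'rV[R]_n -> R^o) a :
  smooth_near f a -> smooth_near h a -> smooth_near (f * h) a.
Proof.
move=> [A [oA Aa Cf]] [B [oB Ba Ch]]; have oAB := openI oA oB.
exists (A `&` B); split=> // k; apply: Ck_onM => //.
  by apply: Ck_on_subset (Cf k) => x [].
by apply: Ck_on_subset (Ch k) => x [].
Qed.

(** Each component comes with its own neighbourhood; there are finitely many, so they have a common
    one. *)
Lemma smooth_near_row {m n} (G : 'rV[R]_m -> 'rV[R]_n) a :
  (forall l, smooth_near (fun x => G x 0 l) a) ->
  exists B, [/\ open B, B a & forall l k, Ck_on k B (fun x => G x 0 l)].
Proof.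
move=> /choice[B sB]; exists [set x | forall l, B l x]°; split.
- exact: open_interior.
- apply: (@filter_forall _ _ B (nbhs a)) => l.
  by have [oB Ba _] := sB l; exact: open_nbhs_nbhs.
- move=> l k; have [_ _ /(_ k)] := sB l; apply: Ck_on_subset.
  by move=> x /interior_subset /(_ l).
Qed.

Lemma smooth_near_comp {m n} (G : 'rV[R]_m -> 'rV[R]_n) (f : 'rV[R]_n -> R^o) a :
  (forall l, smooth_near (fun x => G x 0 l) a) -> smooth_near f (G a) ->
  smooth_near (f \o G) a.
Proof.
move=> /smooth_near_row[B [oB Ba CG]] [A [oA AGa Cf]].
have dG x : B x -> differentiable G x.
  by move=> Bx; apply: differentiable_row => l; have [+ _] := CG l 1%N; apply.
have oBA : open (B `&` (B `&` G @^-1` A)°) by apply: openI (open_interior _).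
(* Taking the interior makes openness immediate, and continuity of [G] at [a] puts [a] in it. *)
exists (B `&` (B `&` G @^-1` A)°); split=> // [|k].
  split=> //; apply: filterI; first exact: open_nbhs_nbhs.
  by apply: (differentiable_continuous (dG a Ba)); exact: open_nbhs_nbhs.
apply: (@Ck_on_comp _ _ _ _ A) => // [x [_ /interior_subset[]//]|x [Bx _]|l].
  exact: dG.
by apply: Ck_on_subset (CG l k) => x [].
Qed.

End smooth_near.

(** * Transfer of neighbourhoods through charts *)

Section charts.
Context {R : realType} {n : nat} {M : manifold R n}.
Implicit Types (p q : M) (c : chart M).

Lemma near_chart_dom c p : chart_dom c p -> \forall q \near p, chart_dom c q.
Proof. by move=> cp; apply: open_nbhs_nbhs; split=> //; exact: open_chart_dom. Qed.

Lemma near_chart_inv c p (P : M -> Prop) : chart_dom c p ->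
  (\forall q \near p, P q) -> \forall x \near chart_map c p, P (chart_inv c x).
Proof.
move=> cp pP; have /= := chart_inv_continuous cp.
by rewrite /prop_for /continuous_at (chart_mapK cp); apply.
Qed.

Lemma near_chart_map c p (P : 'rV[R]_n -> Prop) : chart_dom c p ->
  (\forall x \near chart_map c p, P x) -> \forall q \near p, P (chart_map c q).
Proof. by move=> cp pP; have /= := chart_map_continuous cp; apply. Qed.

Lemma near_chart_invK c p : chart_dom c p ->
  \forall x \near chart_map c p, chart_map c (chart_inv c x) = x.
Proof.
move=> cp; have : nbhs (chart_map c p) (chart_map c @` chart_dom c).
  by apply: open_nbhs_nbhs; split; [exact: open_chart_image|exists p].
by apply: filterS => x [q cq <-]; rewrite chart_mapK.
Qed.

Lemma smooth_map_id : smooth_map (@id M).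
Proof.
split; first by move=> p; exact: cvg_id.
by move=> p c c'; exact: chart_transition_smooth.
Qed.

End charts.

(** * Smooth maps and their differentials in charts *)

Section smooth_maps.
Context {R : realType} {m n : nat} {M : manifold R m} {N : manifold R n}.
Variable i : M -> N.
Hypothesis smi : smooth_map i.

(** The two coordinate expressions agree only locally: [chart_inv c'] inverts [chart_map c'] on the
    chart domain alone, and continuity of [i] keeps nearby points in it. *)
Lemma near_chart_comp p (c : chart M) (c' : chart N) (f : N -> R^o) :
  chart_dom c p -> chart_dom c' (i p) ->
  \forall x \near chart_map c p,
    ((f \o chart_inv c') \o (fun x => chart_map c' (i (chart_inv c x)))) x
      = (f \o i \o chart_inv c) x.
Proof.
move=> cp cip; have : \forall q \near p, chart_dom c' (i q).
  exact: (smi.1 p _ (near_chart_dom cip)).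
by move/(near_chart_inv cp); apply: filterS => x /= ?; rewrite chart_mapK.
Qed.

Lemma smooth_near_chart p (c : chart M) (c' : chart N) (f : N -> R) :
  chart_dom c p -> chart_dom c' (i p) ->
  smooth_near (f \o chart_inv c') (chart_map c' (i p)) ->
  smooth_near (f \o i \o chart_inv c) (chart_map c p).
Proof.
move=> cp cip sf; apply: smooth_near_eq (near_chart_comp f cp cip) _.
apply: smooth_near_comp => [l|]; first exact: (smi.2 p c c' cp cip l).
by rewrite chart_mapK.
Qed.

Lemma smooth_at_comp p (f : N -> R) : smooth_at (i p) f -> smooth_at p (f \o i).
Proof.
move=> sf c cp; have [c' cip] := chart_cover (i p).
exact: (smooth_near_chart cp cip (sf _ cip)).
Qed.

Lemma differential_coord_vec p (c : chart M) (c' : chart N) w :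
  chart_dom c p -> chart_dom c' (i p) ->
  differential i p (coord_vec c w p) =
  coord_vec c' ('D_w (fun x => chart_map c' (i (chart_inv c x))) (chart_map c p)) (i p).
Proof.
move=> cp cip; apply/funext => f; rewrite /differential /coord_vec.
case: asboolP => // sf; rewrite asboolT; last exact: smooth_at_comp.
rewrite -(near_eq_derive _ (near_chart_comp f cp cip)).
rewrite derive_comp_row ?chart_mapK //.
  by apply: differentiable_row => l; exact/smooth_near_differentiable/(smi.2 p c c').
exact/smooth_near_differentiable/sf.
Qed.

Lemma differential_tangent p x : tangent p x -> tangent (i p) (differential i p x).
Proof.
move=> [c [w [cp ->]]]; have [c' cip] := chart_cover (i p).
by rewrite (differential_coord_vec _ cp cip); exists c'; eexists; split.
Qed.

End smooth_maps.

(** * Smooth functions on a manifold *)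

Section smooth_functions.
Context {R : realType} {n : nat} {M : manifold R n}.
Implicit Types (p q : M) (c : chart M) (f h : M -> R).

(** One chart suffices because the identity is a smooth map, its coordinate expressions being the
    transition maps. *)
Lemma smooth_at_chart c p f : chart_dom c p ->
  smooth_near (f \o chart_inv c) (chart_map c p) -> smooth_at p f.
Proof. by move=> cp sf c' c'p; exact: (smooth_near_chart smooth_map_id c'p cp sf). Qed.

Lemma smooth_at_near p f : smooth_at p f -> \forall q \near p, smooth_at q f.
Proof.
move=> sf; have [c cp] := chart_cover p.
have := near_chart_map cp (smooth_near_near (sf c cp)).
have := near_chart_dom cp; apply: filterS2 => q; exact: smooth_at_chart.
Qed.

Lemma smooth_at_eq p f h : (\near p, f p = h p) -> smooth_at p f -> smooth_at p h.
Proof.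
move=> fh sf c cp; apply: smooth_near_eq (sf c cp).
exact: (near_chart_inv (P := fun q => f q = h q) cp fh).
Qed.

Lemma smooth_at_cst p (a : R) : smooth_at p (fun=> a).
Proof. by move=> c cp; exact: smooth_near_cst. Qed.

Lemma smooth_atD p f h :
  smooth_at p f -> smooth_at p h -> smooth_at p (fun q => f q + h q).
Proof. by move=> sf sh c cp; exact: (smooth_nearD (sf c cp) (sh c cp)). Qed.

Lemma smooth_atM p f h :
  smooth_at p f -> smooth_at p h -> smooth_at p (fun q => f q * h q).
Proof. by move=> sf sh c cp; exact: (smooth_nearM (sf c cp) (sh c cp)). Qed.

Lemma smooth_at_coord c p j :
  chart_dom c p -> smooth_at p (fun q => chart_map c q 0 j).
Proof. by move=> cp c' c'p; exact: chart_transition_smooth. Qed.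

End smooth_functions.

(** * Tangent vectors as local derivations, and coordinate fields *)

Section tangent_spaces.
Context {R : realType} {n : nat} {M : manifold R n}.
Implicit Types (p q : M) (c : chart M) (f h : M -> R) (v w : operator R M).

Lemma coord_vecE c u p f : smooth_at p f ->
  coord_vec c u p f = 'D_u (f \o chart_inv c : _ -> R^o) (chart_map c p).
Proof. by rewrite /coord_vec => sf; rewrite asboolT. Qed.

Lemma tangent_not_smooth p v f : tangent p v -> ~ smooth_at p f -> v f = 0.
Proof. by move=> [c [u [cp ->]]] nsf; rewrite /coord_vec asboolF. Qed.

(** Tangent vectors vanish on functions that are not smooth near [p], which matches the default
    value 0 in [differential]. *)
Lemma differential_id p v : tangent p v -> differential id p v = v.
Proof.
move=> tv; apply/funext => f; rewrite /differential; case: asboolP => //.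
by move/(tangent_not_smooth tv).
Qed.

(** A change of chart is the differential of the identity, computed in two different charts. *)
Lemma tangent_chart c p v : chart_dom c p -> tangent p v ->
  exists u, v = coord_vec c u p.
Proof.
move=> cp tv; rewrite -(differential_id tv); have [c' [u [c'p ->]]] := tv.
by rewrite (differential_coord_vec smooth_map_id _ c'p cp); eexists.
Qed.

Lemma coord_vec_linear c p (a : R) u u' : chart_dom c p ->
  coord_vec c (a *: u + u') p = a *: coord_vec c u p + coord_vec c u' p.
Proof.
move=> cp; apply/funext => f; rewrite !fctE /coord_vec.
case: asboolP => sf; last by rewrite scaler0 addr0.
have df := smooth_near_differentiable (sf c cp).
by rewrite !deriveE // linearP.
Qed.

(** The two vectors may be given in different charts, so both are first expressed in a single
    one. *)
Lemma tangent_linear p (a : R) v w :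
  tangent p v -> tangent p w -> tangent p (a *: v + w).
Proof.
have [c cp] := chart_cover p.
move=> /(tangent_chart cp)[u ->] /(tangent_chart cp)[u' ->].
by exists c; eexists; split=> //; rewrite -coord_vec_linear.
Qed.

Lemma tangent0 p : tangent p 0.
Proof.
have [c cp] := chart_cover p; exists c, 0; split=> //; apply/funext => f.
by rewrite /coord_vec derive0 if_same.
Qed.

Lemma tangentD p v w : tangent p v -> tangent p w -> tangent p (v + w).
Proof. by move=> tv tw; rewrite -[v]scale1r; exact: tangent_linear. Qed.

Lemma tangentZ p (a : R) v : tangent p v -> tangent p (a *: v).
Proof. by move=> tv; rewrite -[_ *: _]addr0; apply: tangent_linear => //; exact: tangent0. Qed.

Lemma tangent_sum p k (v : 'I_k -> operator R M) :
  (forall a, tangent p (v a)) -> tangent p (\sum_a v a).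
Proof.
move=> tv; apply: (big_ind (tangent p)) => //; first exact: tangent0.
exact: tangentD.
Qed.

(** Smoothness at [p] depends on the germ alone, so either both functions are smooth and have equal
    derivatives, or both get the default value 0. *)
Lemma tangent_eq p v f h : tangent p v -> (\near p, f p = h p) -> v f = v h.
Proof.
move=> tv fh; have hf : \near p, h p = f p by apply: filterS fh => q ->.
have [sf|nsf] := pselect (smooth_at p f); last first.
  by rewrite !(tangent_not_smooth tv) // => /(smooth_at_eq hf).
have sh := smooth_at_eq fh sf; move: tv => [c [u [cp ->]]].
rewrite !coord_vecE //; apply: near_eq_derive.
exact: (near_chart_inv (P := fun q => f q = h q) cp fh).
Qed.

Lemma tangent_cst p v (a : R) : tangent p v -> v (fun=> a) = 0.
Proof.
move=> [c [u [cp ->]]]; rewrite coord_vecE; last exact: smooth_at_cst.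
exact: derive_cst.
Qed.

Lemma tangent_funD p v f h : tangent p v -> smooth_at p f -> smooth_at p h ->
  v (fun q => f q + h q) = v f + v h.
Proof.
move=> [c [u [cp ->]]] sf sh; rewrite !coord_vecE //; last exact: smooth_atD.
by apply: deriveD; apply/diff_derivable/smooth_near_differentiable; [exact: sf|exact: sh].
Qed.

Lemma tangent_funM p v f h : tangent p v -> smooth_at p f -> smooth_at p h ->
  v (fun q => f q * h q) = f p * v h + h p * v f.
Proof.
move=> [c [u [cp ->]]] sf sh; rewrite !coord_vecE //; last exact: smooth_atM.
rewrite [LHS]deriveM; first by rewrite /= chart_mapK.
all: by apply/diff_derivable/smooth_near_differentiable; [exact: sf || exact: sh].
Qed.

Lemma tangent_coordE c p v : chart_dom c p -> tangent p v ->
  v = \sum_j v (fun q => chart_map c q 0 j) *: coord_vec c (delta_mx 0 j) p.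
Proof.
move=> cp /(tangent_chart cp)[u ->].
have vE j : coord_vec c u p (fun q => chart_map c q 0 j) = u 0 j.
  rewrite coord_vecE; last exact: smooth_at_coord.
  (* Read in the chart [c], the j-th coordinate function is the j-th projection, but only on the
     image of the chart. *)
  rewrite (@near_eq_derive _ _ _ _ (fun x : 'rV[R]_n => x 0 j)).
    by rewrite -derive_rowE // derive_id.
  by have := near_chart_invK cp; apply: filterS => x /= ->.
apply/funext => f; rewrite fct_sumE.
have [sf|nsf] := pselect (smooth_at p f).
  rewrite coord_vecE // derive_row; last exact: smooth_near_differentiable (sf _ _).
  by apply: eq_bigr => j _; rewrite vE [RHS]/GRing.scale /= coord_vecE.
have v0 u' : coord_vec c u' p f = 0 by rewrite /coord_vec asboolF.
by rewrite v0 big1 // => j _; rewrite fctE v0 scaler0.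
Qed.

Lemma smooth_field_coord c p j : chart_dom c p ->
  smooth_field (coord_vec c (delta_mx 0 j)) p.
Proof.
move=> cp; split.
  have := near_chart_dom cp; apply: filterS => q cq.
  by exists c; eexists; split.
move=> f sf; apply: (smooth_at_chart cp).
apply: smooth_near_eq (smooth_near_partial j (sf c cp)).
have := near_chart_inv cp (smooth_at_near sf).
have := near_chart_invK cp; apply: filterS2 => x /= xK sx.
by rewrite coord_vecE // xK.
Qed.

Lemma smooth_field0 p : smooth_field (fun=> 0 : operator R M) p.
Proof.
split; first by apply: filterE => q; exact: tangent0.
by move=> f _; exact: smooth_at_cst.
Qed.

End tangent_spaces.

(** * Vector fields along a map and locality of connections *)

Section fields_along.
Context {R : realType} {m n : nat} {M : manifold R m} {N : manifold R n}.
Variable i : M -> N.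
Hypothesis smi : smooth_map i.
Implicit Types (p q : M) (V W : M -> operator R N) (Z : N -> operator R N).

Lemma near_pullback p (P : N -> Prop) :
  (\forall r \near i p, P r) -> \forall q \near p, P (i q).
Proof. exact: smi.1. Qed.

Lemma smooth_along_eq p V W :
  (\near p, V p = W p) -> smooth_along i V p -> smooth_along i W p.
Proof.
move=> VW [tV sV]; split; first by apply: filterS2 VW tV => q ->.
move=> f /sV; apply: smooth_at_eq.
by apply: filterS VW => q ->.
Qed.

Lemma smooth_along_tangent p V : smooth_along i V p -> tangent (i p) (V p).
Proof. by case=> /nbhs_singleton. Qed.

Lemma smooth_along_comp p Z :
  smooth_field Z (i p) -> smooth_along i (fun q => Z (i q)) p.
Proof.
move=> [tZ sZ]; split; first exact: near_pullback tZ.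
by move=> f /sZ; exact: (smooth_at_comp smi).
Qed.

Lemma smooth_alongD p V W : smooth_along i V p -> smooth_along i W p ->
  smooth_along i (fun q => V q + W q) p.
Proof.
move=> [tV sV] [tW sW]; split.
  by apply: filterS2 tV tW => q; exact: tangentD.
by move=> f sf; apply: (smooth_atD (sV f sf) (sW f sf)).
Qed.

Lemma smooth_alongZ p (f : M -> R) V : smooth_at p f -> smooth_along i V p ->
  smooth_along i (fun q => f q *: V q) p.
Proof.
move=> sf [tV sV]; split; first by apply: filterS tV => q; exact: tangentZ.
by move=> h sh; apply: (smooth_atM sf (sV h sh)).
Qed.

(* A property of germs which holds for restrictions of ambient fields and is
   stable under sums and multiplication by functions holds for every field
   along the map, by expansion in the coordinate fields of a chart. *)
Lemma smooth_along_ind p (P : (M -> operator R N) -> Prop) :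
  (forall V W, smooth_along i V p -> (\near p, V p = W p) -> P V -> P W) ->
  (forall Z, smooth_field Z (i p) -> P (fun q => Z (i q))) ->
  (forall V W, smooth_along i V p -> smooth_along i W p -> P V -> P W ->
    P (fun q => V q + W q)) ->
  (forall (f : M -> R) V, smooth_at p f -> smooth_along i V p -> P V ->
    P (fun q => f q *: V q)) ->
  forall V, smooth_along i V p -> P V.
Proof.
move=> Peq Pcomp PD PZ V sV; have [c cip] := chart_cover (i p).
pose y j (r : N) := chart_map c r 0 j.
pose e j (q : M) := V q (y j) *: coord_vec c (delta_mx 0 j) (i q).
(* Smoothness of the partial sums is carried along because the closure hypotheses on [P] ask for
   it. *)
have [sS PS] : smooth_along i (\sum_j e j) p /\ P (\sum_j e j).
  apply: (big_ind (fun W => smooth_along i W p /\ P W)).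
  - have s0 := smooth_field0 (i p).
    by split; [exact: (smooth_along_comp s0)|exact: (Pcomp _ s0)].
  - move=> V1 V2 [s1 P1] [s2 P2].
    by split; [exact: smooth_alongD|exact: PD].
  - move=> j _; have sf := sV.2 _ (smooth_at_coord j cip).
    have sZ := smooth_field_coord j cip.
    have sc := smooth_along_comp sZ.
    by split; [exact: smooth_alongZ|apply: PZ sf sc (Pcomp _ sZ)].
apply: Peq sS _ PS; have := near_pullback (near_chart_dom cip).
apply: filterS2 sV.1 => q tq cq.
by rewrite [RHS](tangent_coordE cq tq) fct_sumE.
Qed.

Lemma connection_eq D p x V W : connection_along i D -> tangent p x ->
  smooth_along i V p -> (\near p, V p = W p) -> D p x V = D p x W.
Proof.
move=> [_ _ _ DZ _] tx sV VW; have sW := smooth_along_eq VW sV.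
(* Multiplication by the indicator function of the set where V and W agree,
   which is locally constant at p, identifies the two fields globally. *)
pose f q : R := if `[< V q = W q >] then 1 else 0.
have f1 : \forall q \near p, (1 : R) = f q.
  by apply: filterS VW => q ?; rewrite /f asboolT.
have sf : smooth_at p f by apply: smooth_at_eq f1 _; exact: smooth_at_cst.
have xf : x f = 0 by rewrite -(tangent_eq tx f1) (tangent_cst _ tx).
have fp : f p = 1 by rewrite -(nbhs_singleton f1).
have : D p x (fun q => f q *: V q) = D p x (fun q => f q *: W q).
  congr (D p x _); apply/funext => q; rewrite /f.
  by case: asboolP => [->//|_]; rewrite !scale0r.
by rewrite !DZ // xf fp !scale0r !add0r !scale1r.
Qed.

End fields_along.

(** * Bilinearity of the metric on tangent vectors *)

Section semi_riemannian_metric.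
Context {R : realType} {n : nat} {N : manifold R n}.
Variable g : N -> operator R N -> operator R N -> R.
Hypothesis gS : semi_riemannian g.
Implicit Types (p : N) (u v w : operator R N).

Lemma metricC p v w : tangent p v -> tangent p w -> g p v w = g p w v.
Proof. by case: gS => + _ _ _ _; apply. Qed.

Lemma metric_linearl p (a : R) u v w : tangent p u -> tangent p v -> tangent p w ->
  g p (a *: u + v) w = a * g p u w + g p v w.
Proof. by case: gS => _ + _ _ _; apply. Qed.

Lemma metricDl p u v w : tangent p u -> tangent p v -> tangent p w ->
  g p (u + v) w = g p u w + g p v w.
Proof. by move=> tu tv tw; rewrite -{1}[u]scale1r metric_linearl // mul1r. Qed.

Lemma metric0l p w : tangent p w -> g p 0 w = 0.
Proof.
move=> tw; have t0 := tangent0 p; apply: (addrI (g p 0 w)).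
by rewrite -metricDl // !addr0.
Qed.

Lemma metricZl p (a : R) v w : tangent p v -> tangent p w ->
  g p (a *: v) w = a * g p v w.
Proof.
move=> tv tw; have t0 := tangent0 p.
by rewrite -[a *: v]addr0 metric_linearl // metric0l // addr0.
Qed.

Lemma metricNl p v w : tangent p v -> tangent p w -> g p (- v) w = - g p v w.
Proof. by move=> tv tw; rewrite -scaleN1r metricZl // mulN1r. Qed.

Lemma metricBl p u v w : tangent p u -> tangent p v -> tangent p w ->
  g p (u - v) w = g p u w - g p v w.
Proof.
move=> tu tv tw; rewrite metricDl // ?metricNl //.
by rewrite -scaleN1r; exact: tangentZ.
Qed.

Lemma metric_suml p k (v : 'I_k -> operator R N) w :
  (forall a, tangent p (v a)) -> tangent p w ->
  g p (\sum_a v a) w = \sum_a g p (v a) w.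
Proof.
move=> tv tw.
suff [] : tangent p (\sum_a v a) /\ g p (\sum_a v a) w = \sum_a g p (v a) w by [].
apply: (big_ind2 (fun u r => tangent p u /\ g p u w = r)).
- by split; [exact: tangent0|exact: metric0l].
- move=> u _ u' _ [tu <-] [tu' <-].
  by split; [exact: tangentD|exact: metricDl].
- by [].
Qed.

End semi_riemannian_metric.

(** * Compatibility of the pullback connection with the metric *)

Section metric_compatibility.
Context {R : realType} {m n : nat} {M : manifold R m} {N : manifold R n}.
Variables (i : M -> N) (g : N -> operator R N -> operator R N -> R).
Variable nb : N -> operator R N -> (N -> operator R N) -> operator R N.
Variable D : M -> operator R M -> (M -> operator R N) -> operator R N.
Hypotheses (smi : smooth_map i) (gS : semi_riemannian g).
Hypotheses (nb_LC : levi_civita g nb) (D_pull : pullback_connection i nb D).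
Variables (p : M) (x : operator R M).
Hypothesis tx : tangent p x.
Implicit Types V W : M -> operator R N.

(** Smoothness is joined to the product rule because tangent vectors are additive and satisfy the
    Leibniz rule on smooth functions only. *)
Let compatible V W :=
  smooth_at p (fun q => g (i q) (V q) (W q)) /\
  x (fun q => g (i q) (V q) (W q)) =
    g (i p) (D p x V) (W p) + g (i p) (V p) (D p x W).

Let tD V : smooth_along i V p -> tangent (i p) (D p x V).
Proof. by case: D_pull => -[+ _ _ _ _] _; apply. Qed.

Let tV V : smooth_along i V p -> tangent (i p) (V p).
Proof. exact: smooth_along_tangent. Qed.

Let compatibleC V W : smooth_along i V p -> smooth_along i W p ->
  compatible V W -> compatible W V.
Proof.
move=> sV sW [sg xg]; have VW : \forall q \near p,
    g (i q) (V q) (W q) = g (i q) (W q) (V q).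
  by apply: filterS2 sV.1 sW.1 => q; exact: metricC.
split; first exact: smooth_at_eq VW sg.
by rewrite -(tangent_eq tx VW) xg addrC; congr (_ + _); apply: metricC => //;
  do ?[exact: tV | exact: tD].
Qed.

Let compatible_eq V V' W : smooth_along i V p -> (\near p, V p = V' p) ->
  compatible V W -> compatible V' W.
Proof.
move=> sV VV' [sg xg]; have gVV' : \forall q \near p,
    g (i q) (V q) (W q) = g (i q) (V' q) (W q).
  by apply: filterS VV' => q ->.
split; first exact: smooth_at_eq gVV' sg.
by rewrite -(tangent_eq tx gVV') xg (nbhs_singleton VV')
  (connection_eq D_pull.1 tx sV VV').
Qed.

Let compatibleD V V' W : smooth_along i V p -> smooth_along i V' p ->
  smooth_along i W p -> compatible V W -> compatible V' W ->
  compatible (fun q => V q + V' q) W.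
Proof.
move=> sV sV' sW [sg xg] [sg' xg']; have gD : \forall q \near p,
    g (i q) (V q) (W q) + g (i q) (V' q) (W q) = g (i q) (V q + V' q) (W q).
  by apply: filterS3 sV.1 sV'.1 sW.1 => q *; rewrite metricDl.
split; first by apply: smooth_at_eq gD _; exact: smooth_atD.
have [[_ _ DD _ _] _] := D_pull.
rewrite -(tangent_eq tx gD) (tangent_funD tx) // xg xg' DD //.
by rewrite !metricDl //; [rewrite addrACA|exact: tV|exact: tV|exact: tD|
  exact: tD|exact: tD|exact: tV].
Qed.

Let compatibleZ f V W : smooth_at p f -> smooth_along i V p ->
  smooth_along i W p -> compatible V W -> compatible (fun q => f q *: V q) W.
Proof.
move=> sf sV sW [sg xg]; have gZ : \forall q \near p,
    f q * g (i q) (V q) (W q) = g (i q) (f q *: V q) (W q).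
  by apply: filterS2 sV.1 sW.1 => q *; rewrite metricZl.
split; first by apply: smooth_at_eq gZ _; exact: smooth_atM.
have [[_ _ _ DZ _] _] := D_pull.
have [tVp tWp] := (tV sV, tV sW); have [tDV tDW] := (tD sV, tD sW).
rewrite -(tangent_eq tx gZ) (tangent_funM tx) // xg DZ // metric_linearl //.
  by rewrite !metricZl // mulrDr (mulrC (g _ _ _)) addrC addrA.
exact: tangentZ.
Qed.

(** Two nested uses of [smooth_along_ind], exchanged by symmetry, reduce both arguments to
    restrictions of ambient fields. There the pullback connection is the Levi-Civita connection in
    the direction of the image of [x]. *)
Lemma metric_compatible V W : smooth_along i V p -> smooth_along i W p ->
  smooth_at p (fun q => g (i q) (V q) (W q)) /\
  x (fun q => g (i q) (V q) (W q)) =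
    g (i p) (D p x V) (W p) + g (i p) (V p) (D p x W).
Proof.
move=> + sW; move: V; apply: (smooth_along_ind smi) => [V V'|Z sZ|V V'|f V].
- exact: compatible_eq.
- have sZi := smooth_along_comp smi sZ; apply: compatibleC => //.
  move: W sW; apply: (smooth_along_ind smi) => [V V'|Z' sZ'|V V'|f V].
  + exact: compatible_eq.
  + have sgN : smooth_at (i p) (fun r => g r (Z' r) (Z r)).
      by case: gS => _ _ _ + _; apply.
    split; first exact: (smooth_at_comp smi sgN).
    have [_ DZ] := D_pull; have [_ _ nbg] := nb_LC.
    rewrite !DZ // -nbg //; last exact: differential_tangent.
    (* The image of [x] acts on the ambient function through [i] because that function is smooth;
       otherwise it would return 0. *)
    by rewrite /differential asboolT.
  + by move=> sV sV'; exact: compatibleD.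
  + by move=> sf sV; exact: compatibleZ.
- by move=> sV sV'; exact: compatibleD.
- by move=> sf sV; exact: compatibleZ.
Qed.

End metric_compatibility.

(** * Linear algebra of subspaces, components and orthogonal projection *)

Section subspaces.
Context {R : realType} {V : lmodType R}.
Implicit Types A B : set V.

(** Bundles are families of bare sets; for those given by local frames this linear structure is
    recovered from a basis of the fibre. *)
Definition subspace A : Prop :=
  A 0 /\ forall (a : R) u v, A u -> A v -> A (a *: u + v).

Lemma subspaceB A u v : subspace A -> A u -> A v -> A (u - v).
Proof. by move=> [_ AL] Au Av; rewrite addrC -scaleN1r; exact: AL. Qed.

Lemma subspace_sum A k (c : 'I_k -> R) (v : 'I_k -> V) : subspace A ->
  (forall a, A (v a)) -> A (\sum_a c a *: v a).
Proof.
move=> [A0 AL] Av; elim/big_rec: _ => // a u _ Au; exact: AL.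
Qed.

Lemma subspace_vsum A B : subspace A -> subspace B -> subspace (vsum A B).
Proof.
move=> [A0 AL] [B0 BL]; split; first by exists 0, 0; rewrite addr0.
move=> a _ _ [u [u' [Au Bu' ->]]] [v [v' [Av Bv' ->]]].
exists (a *: u + v), (a *: u' + v'); split; [exact: AL|exact: BL|].
by rewrite scalerDr addrACA.
Qed.

Lemma is_basis_mem k A (e : 'I_k -> V) a : is_basis A e -> A (e a).
Proof.
move=> [Ae _]; apply/Ae; exists (fun b => (a == b)%:R).
by rewrite (bigD1 a) //= eqxx scale1r big1 ?addr0 // => b;
  rewrite eq_sym => /negPf ->; rewrite scale0r.
Qed.

Lemma subspace_is_basis k A (e : 'I_k -> V) : is_basis A e -> subspace A.
Proof.
move=> [Ae _]; split.
  by apply/Ae; exists (fun=> 0); rewrite big1 // => a _; rewrite scale0r.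
move=> a u v /Ae[c ->] /Ae[d ->]; apply/Ae; exists (fun b => a * c b + d b).
rewrite scaler_sumr -big_split; apply: eq_bigr => b _ /=.
by rewrite scalerDl scalerA.
Qed.

End subspaces.

Section components.
Context {R : realType} {T : Type}.
Implicit Types (A B : set (T -> R^o)) (u a b : T -> R^o).

Lemma component_add A B a b : subspace A -> subspace B ->
  (forall v, A v -> B v -> v = 0) -> A a -> B b -> component A B (a + b) = a.
Proof.
move=> sA sB AB Aa Bb; rewrite /component.
(* The default value of [xget] is excluded by [a] itself; any other choice [c] differs from [a] by a
   vector of both subspaces. *)
case: xgetP => [c _ [Ac [b' [Bb' E]]]|/(_ a)[]]; last by split=> //; exists b.
apply/esym/subr0_eq/AB; first exact: subspaceB.
rewrite (_ : a - c = b' - b); first exact: subspaceB.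
by apply/eqP; rewrite subr_eq addrAC -subr_eq opprK E addrC.
Qed.

Lemma component_decomp A B u : subspace A -> subspace B ->
  (forall v, A v -> B v -> v = 0) -> vsum A B u ->
  [/\ A (component A B u), B (component B A u) &
      u = component A B u + component B A u].
Proof.
move=> sA sB AB [a [b [Aa Bb ->]]]; rewrite component_add // addrC component_add //.
  by rewrite addrC.
by move=> v Bv Av; exact: AB.
Qed.

End components.

Lemma subbundle_subspace {R : realType} {m n : nat} {M : manifold R m}
    {N : manifold R n} (i : M -> N) (F : M -> set (operator R N)) p :
  subbundle i F -> subspace (F p).
Proof. by move=> [k /(_ p)[e [_ /nbhs_singleton /subspace_is_basis]]]. Qed.

Lemma orthonormal_projection {R : realType} {n : nat} {N : manifold R n}
    (g : N -> operator R N -> operator R N -> R) (P : N)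
    (F : set (operator R N)) k (e : 'I_k -> operator R N) u :
  semi_riemannian g -> is_basis F e -> F `<=` tangent P ->
  (forall a b, if a == b then g P (e a) (e a) = 1 \/ g P (e a) (e a) = -1
               else g P (e a) (e b) = 0) ->
  tangent P u -> exists s, F s /\ forall v, F v -> g P (u - s) v = 0.
Proof.
move=> gS eF FT eo tu; have Fe a : F (e a) := is_basis_mem a eF.
have te a : tangent P (e a) := FT _ (Fe a).
(* In indefinite signature the Fourier coefficient carries the sign g(e_a, e_a), which is its own
   inverse. *)
pose c a := g P (e a) (e a) * g P u (e a); exists (\sum_a c a *: e a).
have Fs : F (\sum_a c a *: e a) by apply: subspace_sum => //; exact: subspace_is_basis eF.
have ts := FT _ Fs; have tus : tangent P (u - \sum_a c a *: e a).
  by rewrite -scaleN1r; apply: tangentD => //; exact: tangentZ.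
split=> // v /eF.1[d ->].
rewrite (metricC gS) //; last by apply: tangent_sum => a; exact: tangentZ.
rewrite (metric_suml gS) //; last by move=> a; exact: tangentZ.
apply: big1 => b _; rewrite (metricZl gS) // (metricC gS) // (metricBl gS) //.
rewrite (metric_suml gS) //; last by move=> a; exact: tangentZ.
rewrite (bigD1 b) //= big1 => [|a ab].
  rewrite (metricZl gS) // addr0 /c mulrAC; have := eo b b; rewrite eqxx.
  by case=> ->; rewrite ?mulrNN !mul1r subrr mulr0.
by rewrite (metricZl gS) //; have := eo a b; rewrite (negPf ab) => ->; rewrite mulr0.
Qed.

(** * The splitting of the ambient tangent space into TM and tr(TM) *)

Section lightlike.
Context {R : realType} {m n : nat} {M : manifold R m} {N : manifold R n}.
Variables (i : M -> N) (g : N -> operator R N -> operator R N -> R).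
Variables S St ltr : M -> set (operator R N).
Hypotheses (smi : smooth_map i) (gS : semi_riemannian g).
Hypothesis light : lightlike_submanifold i g S St ltr.
Implicit Types (p : M) (u v w : operator R N).

Lemma TM_tangent p v : TM i p v -> tangent (i p) v.
Proof. by move=> [x tx <-]; exact: differential_tangent. Qed.

Lemma tangent_lift p v : TM i p v -> tangent p (Defs.lift i p v).
Proof. by move=> [x tx xv]; rewrite /Defs.lift; case: xgetP => [? _ []//|/(_ x)[]]. Qed.

Lemma Rad_subspace p : subspace (Rad i g p).
Proof.
by case: light => -[r [_ Rr]] _ _ _; apply: (subbundle_subspace (i := i)); exists r.
Qed.

Lemma screen_subspace p : subspace (S p).
Proof. by case: light => _ [/subbundle_subspace + _ _] _ _; apply. Qed.

Lemma screen_transversal_subspace p : subspace (St p).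
Proof. by case: light => _ _ [/subbundle_subspace + _ _] _; apply. Qed.

Lemma screen_sub_TM p : S p `<=` TM i p.
Proof.
case: light => _ [_ _ /(_ p)[-> _]] _ _ v Sv; exists 0, v.
by rewrite add0r; split=> //; exact: (Rad_subspace p).1.
Qed.

Lemma screen_transversal_sub_perp p : St p `<=` perp i g (TM i) p.
Proof.
case: light => _ _ [_ _ /(_ p)[-> _]] _ v Sv; exists 0, v.
by rewrite add0r; split=> //; exact: (Rad_subspace p).1.
Qed.

Lemma TM_subspace p : subspace (TM i p).
Proof.
case: (light) => _ [_ _ /(_ p)[-> _]] _ _.
by apply: subspace_vsum; [exact: Rad_subspace|exact: screen_subspace].
Qed.

(** These frames yield both the linear structure of [ltr] and its perfect pairing with Rad TM. *)
Lemma Rad_dual_frames p : exists r (E Nf : 'I_r -> M -> operator R N),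
  [/\ local_frame i (Rad i g) E p, local_frame i ltr Nf p &
   forall a b, [/\ perp i g S p (Nf a p), perp i g St p (Nf a p) &
                   g (i p) (Nf a p) (E b p) = (a == b)%:R]].
Proof.
case: light => -[r [_ /(_ p)[E fE]]] _ _ /(_ _ _ _ fE)[Nf [fN dual]].
exists r, E, Nf; split=> // a b; have [NS NSt _ _] := nbhs_singleton dual a b.
have [_ _ EN _] := nbhs_singleton dual b a; split=> //.
rewrite (metricC gS) 1?eq_sym //; first by case: NS.
by apply: TM_tangent; case: (is_basis_mem b (nbhs_singleton fE.2)).
Qed.

Lemma ltr_coords p r (E Nf : 'I_r -> M -> operator R N) (c : 'I_r -> R) b :
  (forall a, tangent (i p) (Nf a p)) -> tangent (i p) (E b p) ->
  (forall a, g (i p) (Nf a p) (E b p) = (a == b)%:R) ->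
  g (i p) (\sum_a c a *: Nf a p) (E b p) = c b.
Proof.
move=> tN tE dual; rewrite (metric_suml gS) //; last by move=> a; exact: tangentZ.
rewrite (bigD1 b) //= big1 => [|a ab].
  by rewrite (metricZl gS) // dual eqxx mulr1 addr0.
by rewrite (metricZl gS) // dual (negPf ab) mulr0.
Qed.

Lemma ltr_subspace p : subspace (ltr p).
Proof.
by have [r [E [Nf [_ fN _]]]] := Rad_dual_frames p; exact: subspace_is_basis (nbhs_singleton fN.2).
Qed.

Lemma ltr_perp p v : ltr p v -> perp i g S p v /\ perp i g St p v.
Proof.
have [r [E [Nf [_ fN dual]]]] := Rad_dual_frames p.
move=> /(nbhs_singleton fN.2).1[c ->].
have tN a : tangent (i p) (Nf a p) by have [[]] := dual a a.
have tNc a : tangent (i p) (c a *: Nf a p) by exact: tangentZ.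
split; split; try exact: tangent_sum; move=> w Fw.
- have tw : tangent (i p) w by exact/TM_tangent/screen_sub_TM.
  rewrite (metric_suml gS) // big1 // => a _; rewrite (metricZl gS) //.
  by have [[_ NS] _ _] := dual a a; rewrite NS // mulr0.
- have [tw _] := screen_transversal_sub_perp Fw.
  rewrite (metric_suml gS) // big1 // => a _; rewrite (metricZl gS) //.
  by have [_ [_ NSt] _] := dual a a; rewrite NSt // mulr0.
Qed.

(** Pairing with the dual vector [E b] reads off the b-th coefficient of [v]. *)
Lemma ltr_Rad_nondegenerate p v : ltr p v ->
  (forall w, Rad i g p w -> g (i p) v w = 0) -> v = 0.
Proof.
have [r [E [Nf [fE fN dual]]]] := Rad_dual_frames p.
move=> /(nbhs_singleton fN.2).1[c ->] v0; apply: big1 => b _.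
have RE := is_basis_mem b (nbhs_singleton fE.2).
suff <- : g (i p) (\sum_a c a *: Nf a p) (E b p) = c b by rewrite v0 // scale0r.
apply: ltr_coords => [a| |a]; first by have [[]] := dual a a.
  by apply: TM_tangent; case: RE.
by have [_ _ ->] := dual a b.
Qed.

Lemma tr_subspace p : subspace (tr St ltr p).
Proof. by apply: subspace_vsum; [exact: ltr_subspace|exact: screen_transversal_subspace]. Qed.

Lemma tr_tangent p v : tr St ltr p v -> tangent (i p) v.
Proof.
move=> [u [w [/ltr_perp[[tu _] _] /screen_transversal_sub_perp[tw _] ->]]].
exact: tangentD.
Qed.

Lemma tr_perp_screen p v w : tr St ltr p v -> S p w -> g (i p) v w = 0.
Proof.
move=> [u [t [/ltr_perp[[tu uS] _] /screen_transversal_sub_perp[tt tTM] ->]]] Sw.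
have TMw := screen_sub_TM Sw.
by rewrite (metricDl gS) ?uS ?tTM ?addr0 //; exact: TM_tangent.
Qed.

(** The part in S(TM^perp) is orthogonal to TM, so Rad TM sees only the part in [ltr], which the
    perfect pairing then forces to vanish. *)
Lemma tr_perp_Rad p v : tr St ltr p v ->
  (forall w, Rad i g p w -> g (i p) v w = 0) -> St p v.
Proof.
move=> [u [t [lu St_t ->]]] v0; have [[tu _] _] := ltr_perp lu.
have [tt tTM] := screen_transversal_sub_perp St_t.
suff -> : u = 0 by rewrite add0r.
apply: (ltr_Rad_nondegenerate lu) => w Rw; have [TMw _] := Rw.
have := v0 w Rw; rewrite (metricDl gS) ?(tTM w) ?addr0 //; exact: TM_tangent.
Qed.

(** A vector of TM is orthogonal to Rad TM, so a common vector lies in S(TM^perp). It is then both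
    tangent and normal to M, hence in Rad TM, which meets S(TM^perp) in 0. *)
Lemma TM_tr_disjoint p v : TM i p v -> tr St ltr p v -> v = 0.
Proof.
move=> TMv trv; have tv := TM_tangent TMv.
have Stv : St p v.
  apply: (tr_perp_Rad trv) => w [TMw [tw wTM]].
  by rewrite (metricC gS) // wTM.
case: light => _ _ [_ _ /(_ p)[_ dis]] _; apply: dis => //.
by split=> //; exact: screen_transversal_sub_perp.
Qed.

Lemma St_ltr_disjoint p v : St p v -> ltr p v -> v = 0.
Proof.
move=> /screen_transversal_sub_perp[_ vTM] lv.
by apply: (ltr_Rad_nondegenerate lv) => w [TMw _]; exact: vTM.
Qed.

(* Subtracting from u its projections to S, to St and to ltr (along the dual
   frame of Rad) leaves a vector of T M^perp orthogonal to St, i.e. of Rad. *)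
Lemma TM_tr_decomp p k (e : 'I_k -> M -> operator R N)
    l (W : 'I_l -> M -> operator R N) u :
  orthonormal_frame i g S e p -> orthonormal_frame i g St W p ->
  tangent (i p) u -> vsum (TM i p) (tr St ltr p) u.
Proof.
move=> [[_ be] oe] [[_ bW] oW] tu.
have ST : S p `<=` tangent (i p) by move=> v /screen_sub_TM /TM_tangent.
have StT : St p `<=` tangent (i p) by move=> v /screen_transversal_sub_perp[].
have [s [Ss sP]] := orthonormal_projection gS (nbhs_singleton be) ST (nbhs_singleton oe) tu.
have [t [Stt tP]] := orthonormal_projection gS (nbhs_singleton bW) StT (nbhs_singleton oW) tu.
have [r [E [Nf [fE fN dual]]]] := Rad_dual_frames p.
have tN a : tangent (i p) (Nf a p) by have [[]] := dual a a.
(* As [s] and [t] are orthogonal to Rad TM, these coefficients make u - s - t - v orthogonal to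
   every [E a]. *)
pose c a := g (i p) u (E a p); pose v := \sum_a c a *: Nf a p.
have lv : ltr p v by apply/(nbhs_singleton fN.2).1; exists c.
have [[tv vS] [_ vSt]] := ltr_perp lv.
have [ts tt] := (ST _ Ss, StT _ Stt); have [_ tTM] := screen_transversal_sub_perp Stt.
have TMs := screen_sub_TM Ss.
have tB x y : tangent (i p) x -> tangent (i p) y -> tangent (i p) (x - y).
  by move=> tx ty; rewrite -scaleN1r; apply: tangentD => //; exact: tangentZ.
pose x := u - s - t - v.
have tx1 := tB _ _ tu ts; have tx2 := tB _ _ tx1 tt.
have tx : tangent (i p) x := tB _ _ tx2 tv.
have xE w : tangent (i p) w -> g (i p) x w =
    g (i p) u w - g (i p) s w - g (i p) t w - g (i p) v w.
  by move=> tw; rewrite !(metricBl gS).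
have xS w : S p w -> g (i p) x w = 0.
  move=> Sw; rewrite xE; last exact: ST.
  rewrite -(metricBl gS) //; last exact: ST.
  by rewrite sP // (tTM _ (screen_sub_TM Sw)) vS // !subr0.
have xRad w : Rad i g p w -> g (i p) x w = 0.
  move=> Rw; have := Rw => /(nbhs_singleton fE.2).1[d wE].
  have tE b : tangent (i p) (E b p).
    by apply: TM_tangent; case: (is_basis_mem b (nbhs_singleton fE.2)).
  rewrite wE (metricC gS) //; last by apply: tangent_sum => b; exact: tangentZ.
  rewrite (metric_suml gS) //; last by move=> b; exact: tangentZ.
  apply: big1 => b _; rewrite (metricZl gS) // (metricC gS) // xE //.
  have [TME [_ ETM]] := is_basis_mem b (nbhs_singleton fE.2).
  rewrite (metricC gS ts) // ETM // tTM // ltr_coords //.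
    by rewrite !subr0 subrr mulr0.
  by move=> a; have [_ _ ->] := dual a b.
have xSt w : St p w -> g (i p) x w = 0.
  move=> Stw; have [tw wTM] := screen_transversal_sub_perp Stw.
  rewrite xE // (metricC gS ts) // wTM // vSt // !subr0 -(metricBl gS) //.
  exact: tP.
have [rho [om [Rrho Stom xro]]] : vsum (Rad i g p) (St p) x.
  case: (light) => _ _ [_ _ /(_ p)[<- _]] _; split=> // w.
  case: (light) => _ [_ _ /(_ p)[-> _]] _ _ [w1 [w2 [Rw1 Sw2 ->]]].
  have tw1 : tangent (i p) w1 by apply: TM_tangent; case: Rw1.
  have tw2 := ST _ Sw2.
  rewrite (metricC gS) //; last exact: tangentD.
  by rewrite (metricDl gS) // (metricC gS tw1 tx) (metricC gS tw2 tx) // xRad // xS // addr0.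
have [TMrho [trho rhoTM]] := Rrho; have tom := StT _ Stom.
(* Both [x] and [rho] are orthogonal to S(TM^perp), so [om] is orthogonal to the non-degenerate
   space that contains it. *)
have om0 : om = 0.
  case: (light) => _ _ [_ /(_ p) nd _] _; apply: nd => // w Stw.
  have [tw wTM] := screen_transversal_sub_perp Stw.
  have := xSt w Stw; rewrite xro (metricDl gS) // (metricC gS trho) // wTM //.
  by rewrite add0r.
exists (rho + s), (v + t); split.
- by have [_ TML] := TM_subspace p; rewrite -[rho]scale1r; exact: TML.
- by exists v, t.
- rewrite om0 addr0 in xro; rewrite -xro /x.
  by rewrite [RHS]addrAC [_ + (v + t)]addrA !subrK.
Qed.

End lightlike.

(** * Second fundamental form, shape operators and minimality *)

Section minimality.
Context {R : realType} {m n : nat} {M : manifold R m} {N : manifold R n}.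
Variables (i : M -> N) (g : N -> operator R N -> operator R N -> R).
Variable nb : N -> operator R N -> (N -> operator R N) -> operator R N.
Variable D : M -> operator R M -> (M -> operator R N) -> operator R N.
Variables S St ltr : M -> set (operator R N).
Hypotheses (smi : smooth_map i) (gS : semi_riemannian g).
Hypotheses (nb_LC : levi_civita g nb) (D_pull : pullback_connection i nb D).
Hypothesis light : lightlike_submanifold i g S St ltr.
Hypothesis irrot : irrotational i g D.

Let TM_tr_component p u : vsum (TM i p) (tr St ltr p) u ->
  [/\ TM i p (component (TM i p) (tr St ltr p) u),
      tr St ltr p (component (tr St ltr p) (TM i p) u) &
      u = component (TM i p) (tr St ltr p) u + component (tr St ltr p) (TM i p) u].
Proof.
apply: component_decomp; first exact: TM_subspace light p.
  exact: tr_subspace smi gS light p.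
exact: (TM_tr_disjoint smi gS light).
Qed.

Lemma sff_s_Rad p (E E' : M -> operator R N) :
  is_section i (Rad i g) E p -> is_section i (Rad i g) E' p ->
  sff_s i D St ltr p (E p) E' = 0.
Proof.
move=> [_ /nbhs_singleton[TME _]] sE'; rewrite /sff_s /sff.
have Sp := screen_transversal_subspace light p.
have lp := ltr_subspace smi gS light p.
(* By irrotationality the derivative of [E'] is tangent to M, so its transversal part is read off
   the decomposition 0 + u; the zero vector is then split in the same way. *)
rewrite -[cov i D p _ _]add0r component_add.
- rewrite -[0 in LHS]addr0 component_add //; [|exact: Sp.1|exact: lp.1].
  exact: (St_ltr_disjoint smi gS light).
- exact: tr_subspace smi gS light p.
- exact: TM_subspace light p.
- by move=> v trv TMv; exact: (TM_tr_disjoint smi gS light TMv).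
- exact: (tr_subspace smi gS light p).1.
- exact: irrot.
Qed.

Section orthonormal_frames.
Variables (p : M) (k l : nat).
Variables (e : 'I_k -> M -> operator R N) (W : 'I_l -> M -> operator R N).
Hypotheses (fe : orthonormal_frame i g S e p) (fW : orthonormal_frame i g St W p).

Let TMe a : TM i p (e a p).
Proof.
exact: (screen_sub_TM light (is_basis_mem a (nbhs_singleton fe.1.2))).
Qed.

Let cov_tangent v V : TM i p v -> smooth_along i V p -> tangent (i p) (cov i D p v V).
Proof.
by move=> TMv sV; case: D_pull => -[+ _ _ _ _] _; apply=> //; exact: tangent_lift.
Qed.

(** The orthonormal frames of S(TM) and S(TM^perp) enter here: they provide the projections that
    make the decomposition exist. *)
Let Gauss v V : TM i p v -> smooth_along i V p ->
  [/\ TM i p (induced_connection i D St ltr p v V), tr St ltr p (sff i D St ltr p v V) &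
      cov i D p v V = induced_connection i D St ltr p v V + sff i D St ltr p v V].
Proof.
move=> TMv sV; apply: TM_tr_component; apply: (TM_tr_decomp smi gS light fe fW).
exact: cov_tangent.
Qed.

Let section_TM a : is_section i (TM i) (e a) p.
Proof.
split; first exact: fe.1.1.
by apply: filterS fe.1.2 => q bq; exact: (screen_sub_TM light (is_basis_mem a bq)).
Qed.

(* Irrotationality and metricity of the induced connection make g(h(X, Y), E)
   vanish for E in Rad T M, which kills the ltr-component of h(X, Y). *)
Lemma sff_screen_transversal a : metric_induced_connection i g D St ltr ->
  St p (sff i D St ltr p (e a p) (e a)).
Proof.
move=> metric; have sV : smooth_along i (e a) p := fe.1.1 a.
have [TMc trh cE] := Gauss (TMe a) sV.
have [r [E [Nf [fE _ _]]]] := Rad_dual_frames smi gS light p.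
have th := tr_tangent smi gS light trh; have tc := TM_tangent smi TMc.
have RE b : Rad i g p (E b p) := is_basis_mem b (nbhs_singleton fE.2).
have tE b : tangent (i p) (E b p) by apply: (TM_tangent smi); case: (RE b).
apply: (tr_perp_Rad smi gS light trh) => w /(nbhs_singleton fE.2).1[d ->].
rewrite (metricC gS th); last by apply: tangent_sum => b; exact: tangentZ.
rewrite (metric_suml gS) //; last by move=> b; exact: tangentZ.
apply: big1 => b _; rewrite (metricZl gS) // (metricC gS (tE b) th).
have sE := fE.1 b; have secE : is_section i (Rad i g) (E b) p.
  by split=> //; apply: filterS fE.2 => q bq; exact: (is_basis_mem b bq).
have TME : is_section i (TM i) (E b) p.
  by split=> //; apply: filterS secE.2 => q [].
have TMcE := irrot (TMe a) secE.
have indE : induced_connection i D St ltr p (e a p) (E b) = cov i D p (e a p) (E b).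
  rewrite /induced_connection -[in LHS](addr0 (cov _ _ _ _ _)); apply: component_add => //.
  - exact: TM_subspace light p.
  - exact: tr_subspace smi gS light p.
  - exact: (TM_tr_disjoint smi gS light).
  - exact: (tr_subspace smi gS light p).1.
have [_ [tEb ETM]] := RE b.
have [_ compat] := metric_compatible smi gS nb_LC D_pull (tangent_lift (TMe a)) sV sE.
have := metric p (e a p) (e a) (E b) (TMe a) (section_TM a) TME.
(* The terms with the derivative of [E b] cancel, and the tangential part of the derivative of [e a]
   pairs to 0 with Rad TM; only g(h(e_a, e_a), E_b) is left. *)
rewrite compat indE -/(cov i D p (e a p) (e a)) -/(cov i D p (e a p) (E b)) cE.
rewrite (metricDl gS) // (metricC gS tc (tE b)) ETM // add0r subr0 addrK.
by move=> ->; rewrite mulr0.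
Qed.

Lemma metric_sff_shape a b :
  g (i p) (sff i D St ltr p (e a p) (e a)) (W b p) =
  g (i p) (Defs.shape i D St ltr (W b) p (e a p)) (e a p).
Proof.
have sV : smooth_along i (e a) p := fe.1.1 a.
have sW : smooth_along i (W b) p := fW.1.1 b.
have [TMc trh cE] := Gauss (TMe a) sV.
have [TMs trs sE] := Gauss (TMe a) sW.
have th := tr_tangent smi gS light trh; have tc := TM_tangent smi TMc.
have ts := TM_tangent smi TMs; have tte := tr_tangent smi gS light trs.
have te := TM_tangent smi (TMe a).
have [tW WTM] := screen_transversal_sub_perp light
  (is_basis_mem b (nbhs_singleton fW.1.2)).
have [_ compat] := metric_compatible smi gS nb_LC D_pull (tangent_lift (TMe a)) sV sW.
(* Orthogonality is needed on a neighbourhood, so that the derivative of the product at [p]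
   vanishes. *)
have eW0 : \forall q \near p, g (i q) (e a q) (W b q) = 0.
  apply: filterS2 (section_TM a).2 fW.1.2 => q TMeq bq.
  have [tWq WTMq] := screen_transversal_sub_perp light (is_basis_mem b bq).
  by rewrite (metricC gS) ?WTMq //; exact: TM_tangent.
move: compat; rewrite (tangent_eq (tangent_lift (TMe a)) eW0).
rewrite (tangent_cst _ (tangent_lift (TMe a))).
rewrite -/(cov i D p (e a p) (e a)) -/(cov i D p (e a p) (W b)) cE sE.
rewrite (metricDl gS) // (metricC gS tc tW) WTM // add0r.
rewrite (metricC gS te); last exact: tangentD.
(* The transversal part of the derivative of [W b] is orthogonal to S(TM), which leaves the
   tangential part, minus the shape operator. *)
rewrite (metricDl gS) // (tr_perp_screen smi gS light trs); last first.
  exact: (is_basis_mem a (nbhs_singleton fe.1.2)).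
rewrite addr0 /Defs.shape (metricNl gS) // => /esym/eqP.
by rewrite addr_eq0 => /eqP.
Qed.

Lemma trace_sff_eq0 : metric_induced_connection i g D St ltr ->
  (forall b, trace_shape i g D St ltr e (W b) p = 0) ->
  trace_sff i g D St ltr e p = 0.
Proof.
move=> metric tr0; have hSt a := sff_screen_transversal a metric.
have tangSt v : St p v -> tangent (i p) v.
  by move/(screen_transversal_sub_perp light) => -[].
have StT : St p (trace_sff i g D St ltr e p).
  exact: (subspace_sum _ (screen_transversal_subspace light p)).
(* The trace lies in the non-degenerate S(TM^perp), so it is enough to pair it with the frame [W],
   which gives the traces of the shape operators. *)
case: (light) => _ _ [_ /(_ p) nd _] _; apply: nd => // w.
have StW b := is_basis_mem b (nbhs_singleton fW.1.2).
move=> /(nbhs_singleton fW.1.2).1[d ->].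
rewrite (metricC gS) //; [|exact: tangSt|by apply: tangent_sum => b; apply/tangentZ/tangSt/StW].
rewrite (metric_suml gS); [|by move=> b; apply/tangentZ/tangSt/StW|exact: tangSt].
apply: big1 => b _; have tW := tangSt _ (StW b).
rewrite (metricZl gS) // ?(metricC gS tW) //; try exact: tangSt.
rewrite /trace_sff (metric_suml gS) //; last by move=> a; apply/tangentZ/tangSt/hSt.
transitivity (d b * trace_shape i g D St ltr e (W b) p); last by rewrite tr0 mulr0.
congr (_ * _).
apply: eq_bigr => a _.
by rewrite (metricZl gS) ?metric_sff_shape //; exact: tangSt.
Qed.

End orthonormal_frames.
End minimality.

Theorem theorem4p8 (R : realType) (n m : nat)
    (N : manifold R n)
    (phi : N -> operator R N -> operator R N)
    (xi : N -> operator R N)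
    (eta : N -> operator R N -> R)
    (g : N -> operator R N -> operator R N -> R)
    (nb : N -> operator R N -> (N -> operator R N) -> operator R N)
    (mu : R)
    (M : manifold R m) (i : M -> N)
    (D : M -> operator R M -> (M -> operator R N) -> operator R N)
    (S St ltr : M -> set (operator R N))
    (n_odd : odd n)
    (contact : almost_contact_metric g phi xi eta)
    (nb_LC : levi_civita g nb)
    (sasaki : nearly_sasakian g nb mu phi xi eta)
    (sub : immersed_submanifold i)
    (D_pull : pullback_connection i nb D)
    (light : lightlike_submanifold i g S St ltr)
    (qgcr : proper_QGCR i g phi S St ltr)
    (asc : ascreen i g xi ltr)
    (irrot : irrotational i g D)
    (metric : metric_induced_connection i g D St ltr)
    (trace0 : trace_free_shape i g D S St ltr) :
  minimal i g D S St ltr.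
Proof.
have [_ smi _] := sub; have [gS _ _ _ _] := contact.
split=> [p E E'|p k e fe]; first exact: (sff_s_Rad smi gS light irrot).
(* The trace of h is a pointwise condition, so trace-freeness is taken at [p] itself. *)
have [l [W [fW /nbhs_singleton tr0]]] := trace0 p.
apply: (trace_sff_eq0 smi gS nb_LC D_pull light irrot fe fW metric) => b.
exact: tr0.
Qed.
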